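(* For an integer $\Delta \ge 1$, let $N^{at}(\Delta, 2)$ denote the maximum order (number of vertices) of an arc-transitive graph of degree $\Delta$ and diameter at most $2$. Then the following hold. (a) For any even integer $\Delta \ge 2$, $$N^{at}(\Delta, 2) \ge \frac{1}{4}(\Delta + 2)^2.$$ (b) For any real number $\varepsilon$ with $0 < \varepsilon < 1$, there exist infinitely many odd integers $\Delta$ of the form $\Delta = q^{3}(q^{d-2} - 1)/(q-1)$, where $q$ is an odd prime power and $d \ge 3/\varepsilon$ is an odd integer, such that $$N^{at}(\Delta, 2) > \Delta^{2 - \varepsilon} + 2\Delta^{1 - \frac{\varepsilon}{3}} + \Delta^{1 - \frac{2\varepsilon}{3}} + 3.$$
   Context: All graphs are finite and undirected with no loops or multiple edges. An arc of a graph is an ordered pair of adjacent vertices. A graph is vertex-transitive if its automorphism group is transitive on its vertex set. A graph is arc-transitive if it is vertex-transitive and in addition its automorphism group is transitive on the set of arcs. ''Degree $\Delta$'' means that the graph is regular with every vertex of degree $\Delta$. *)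

(* Defs.v *)
From HB Require Import structures.
From mathcomp Require Import all_boot all_order all_algebra all_fingroup.
From mathcomp Require Import all_classical all_reals all_analysis.

Set Implicit Arguments.
Unset Strict Implicit.
Unset Printing Implicit Defensive.

Record sgraph := SGraph {
  vertex :> finType;
  adj : rel vertex;
  adj_sym : symmetric adj;
  adj_irrefl : irreflexive adj }.

Definition graph_order (G : sgraph) : nat := #|G|.

Definition aut (G : sgraph) : {set {perm G}} :=
  [set f : {perm G} | [forall x, forall y, adj (f x) (f y) == adj x y]].

Lemma aut_group_set (G : sgraph) : group_set (aut G).
Proof.
apply/group_setP; split=> [|f g]; rewrite !inE.
  by apply/'forall_'forall_eqP => x y; rewrite !perm1.
move=> /'forall_'forall_eqP fA /'forall_'forall_eqP gA.
by apply/'forall_'forall_eqP => x y; rewrite !permM gA fA.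
Qed.

Canonical aut_group (G : sgraph) := Group (aut_group_set G).

Definition vertex_transitive (G : sgraph) : Prop :=
  forall x y : G, exists2 f, f \in aut G & f x = y.

Definition arc_transitive (G : sgraph) : Prop :=
  vertex_transitive G /\
  forall x y u v : G, adj x y -> adj u v ->
    exists2 f, f \in aut G & f x = u /\ f y = v.

Definition has_degree (G : sgraph) (D : nat) : Prop :=
  forall x : G, #|[set y | adj x y]| = D.

(* Every pair of vertices is joined by a path with at most [k] edges; in
   particular the graph is connected. *)
Definition diameter_le (G : sgraph) (k : nat) : Prop :=
  forall x y : G, exists p : seq G,
    [/\ path (@adj G) x p, last x p = y & size p <= k].

Definition at_order (D k n : nat) : Prop :=
  exists G : sgraph,
    [/\ arc_transitive G, has_degree G D, diameter_le G k & graph_order G = n].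

Definition is_max_at_order (D k N : nat) : Prop :=
  at_order D k N /\ forall n, at_order D k n -> n <= N.

(* The default value 0 is never used when k is positive: see [N_atP]. *)
Definition N_at (D k : nat) : nat :=
  xget 0 [set N | is_max_at_order D k N]%classic.

Lemma leq_card_bigcup (I T : finType) (P : pred I) (F : I -> {set T}) :
  #|\bigcup_(i | P i) F i| <= \sum_(i | P i) #|F i|.
Proof.
elim/big_rec2: _ => [|i m A _ IH]; first by rewrite cards0.
by apply: leq_trans (leq_card_setU _ _) _; rewrite leq_add2l.
Qed.

(* A Moore-type bound, needed only for the existence of the maximum. *)
Lemma at_order_bound (D k n : nat) :
  at_order D k n -> n <= \sum_(i < k.+1) D ^ i.
Proof.
case=> G [_ degG diaG <-]; rewrite /graph_order.
case: (pickP (mem G)) => [x _|G0]; last by rewrite eq_card0.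
pose B := fix B i : {set G} :=
  if i is j.+1 then \bigcup_(y in B j) [set z | adj y z] else [set x].
have cardB i : #|B i| <= D ^ i.
  elim: i => [|i IH] /=; first by rewrite cards1.
  apply: leq_trans (leq_card_bigcup _ _) _.
  rewrite (eq_bigr (fun=> D)) => [|y _]; last exact: degG.
  by rewrite sum_nat_const expnSr leq_mul2r IH orbT.
have memB p : path (@adj G) x p -> last x p \in B (size p).
  elim/last_ind: p => [|p z IH] /=; first by rewrite inE.
  rewrite rcons_path last_rcons size_rcons => /andP[/IH pB pz] /=.
  by apply/bigcupP; exists (last x p); rewrite ?inE.
apply: (@leq_trans (\sum_(i < k.+1) #|B i|)); last exact: leq_sum.
apply: leq_trans (leq_card_bigcup _ _).
apply/subset_leq_card/fintype.subsetP => y _; have [p [xp <- pk]] := diaG x y.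
have pk1 : size p < k.+1 by [].
by apply/bigcupP; exists (Ordinal pk1) => //; apply: memB.
Qed.

Definition complete_graph (n : nat) : sgraph.
Proof.
refine (@SGraph 'I_n (fun x y => x != y) _ _) => [x y|x].
- by rewrite eq_sym.
- by rewrite eqxx.
Defined.

Lemma at_order_complete (D k : nat) : 0 < k -> at_order D k D.+1.
Proof.
move=> k0; exists (complete_graph D.+1).
have autT (f : {perm 'I_D.+1}) : f \in aut (complete_graph D.+1).
  rewrite inE; apply/'forall_'forall_eqP => x y /=.
  by rewrite (inj_eq perm_inj).
split=> /=.
- split=> [x y|x y u v /= xy uv].
    by exists (tperm x y); rewrite ?autT ?tpermL.
  pose g := tperm x u; exists (g * tperm (g y) v)%g; first exact: autT.
  rewrite !permM tpermL tpermL; split=> //.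
  have gyu : g y != u.
    by rewrite -[X in _ != X](tpermL x u) (inj_eq perm_inj) eq_sym.
  by rewrite tpermD // eq_sym.
- move=> x; have -> : [set y | x != y] = ~: [set x].
    by apply/setP => y; rewrite !inE eq_sym.
  by rewrite cardsC1 card_ord.
- move=> x y; have [->|xy] := eqVneq x y; first by exists [::].
  by exists [:: y]; rewrite /= xy.
- by rewrite /graph_order card_ord.
Qed.

Lemma N_atP (D k : nat) : 0 < k -> is_max_at_order D k (N_at D k).
Proof.
move=> k0.
have exP : exists n, `[< at_order D k n >].
  by exists D.+1; apply/asboolP/at_order_complete.
have ubP n : `[< at_order D k n >] -> n <= \sum_(i < k.+1) D ^ i.
  by move/asboolP/at_order_bound.
case: (ex_maxnP exP ubP) => N /asboolP NP Nmax.
have maxN : is_max_at_order D k N.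
  by split=> // n nP; apply: Nmax; apply/asboolP.
have ex : exists N, [set N | is_max_at_order D k N]%classic N by exists N.
exact: xgetPex ex.
Qed.

Definition prime_power (q : nat) : Prop :=
  exists p k : nat, [/\ prime p, 0 < k & q = p ^ k].

(* Main.v *)
(** For (a), take the Hamming graph H(2, k) with k = D/2 + 1.

    For (b), take the incident point-line pairs (P, L) of PG(d - 1, q), with
    (P, L) adjacent to (Q, M) when L and M meet, P is not on M, Q is not on L.
    Writing R for the point L /\ M, arcs correspond to ordered triples (P, R, Q)
    of non-collinear points, on which GL(d, q) is transitive. If L and M are
    distinct, choose a on L off P and M, and b on M off Q and L; the flag
    (<a + b>, <a, b>) is adjacent to both (P, L) and (Q, M). If L = M, any flag
    whose line meets L in a third point will do. With x = 1 + q + ... + q^(d-3),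
    the degree is q^3 x and the order is
    (1 + q + q^2 x)(1 + q x) = q^3 x^2 + 2 q^2 x + q x + q + 1.
    Only q = 3 is needed for infinitely many degrees. *)

Require Import Defs.
From mathcomp Require Import all_boot all_order all_algebra.
From mathcomp Require Import all_classical all_reals all_analysis.
From mathcomp Require Import fintype finset fingroup perm mxabelem.
From mathcomp Require Import zify ring lra.
Import Order.TTheory GRing.Theory Num.Theory.

Set Implicit Arguments.
Unset Strict Implicit.
Unset Printing Implicit Defensive.

(** * Tools on maximal orders, automorphisms and counting *)

Lemma N_at_ge (D k n : nat) : 0 < k -> at_order D k n -> n <= N_at D k.
Proof. by move=> k0; apply: (N_atP D k0).2. Qed.

Lemma perm_pair_transitive (T : finType) (a b c d : T) :
  (a == b) = (c == d) -> exists f : {perm T}, f a = c /\ f b = d.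
Proof.
have [<- /esym/eqP<-|ab /esym/negbT cd] := eqVneq a b.
  by exists (tperm a c); rewrite tpermL.
(* The first transposition sends [a] to [c]; the second fixes [c] and corrects the image of [b]. *)
exists (tperm a c * tperm (tperm a c b) d)%g; rewrite !permM !tpermL.
split=> //; apply: tpermD; rewrite 1?eq_sym //.
by rewrite -[X in X != _](tpermL a c) (inj_eq perm_inj).
Qed.

Lemma aut_of_mono (G : sgraph) (h : G -> G) :
  injective h -> {mono h : x y / adj x y} -> exists2 f, f \in aut G & f =1 h.
Proof.
move=> hI hA; exists (perm hI); last exact: permE.
by rewrite inE; apply/'forall_'forall_eqP => x y; rewrite !permE; apply: hA.
Qed.

(** Flags and their neighbours are counted through the pairs of vectors that span them, all fibres
    having the same size. *)
Lemma card_fibers (T U : finType) (f : T -> U) (D : {set T}) (E : {set U}) k :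
  {in D, forall x, f x \in E} ->
  {in E, forall y, #|[set x in D | f x == y]| = k} -> #|D| = #|E| * k.
Proof.
move=> fDE fk; rewrite -sum1_card (partition_big f (mem E)) //= -sum_nat_const.
apply: eq_bigr => y /fk <-; rewrite -sum1_card.
by apply: eq_bigl => x; rewrite inE.
Qed.

Lemma subn1_exp (a k : nat) : a ^ k - 1 = (a - 1) * \sum_(i < k) a ^ i.
Proof. by rewrite !subn1 predn_exp. Qed.

Lemma odd_geometric_sum (q k : nat) : odd q -> odd (\sum_(i < k) q ^ i) = odd k.
Proof.
move=> oq; elim: k => [|k IHk]; first by rewrite big_ord0.
by rewrite big_ord_recr oddD IHk oddX oq orbT addbT.
Qed.

(** * Hamming graphs *)

Section Hamming.
Variable k : nat.

(** The exclusive or says that exactly one coordinate agrees; this is the rook's graph, the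
    Cartesian square of a complete graph. *)
Definition hamming_adj : rel ('I_k * 'I_k) :=
  fun x y => (x.1 == y.1) (+) (x.2 == y.2).

Lemma hamming_adj_sym : symmetric hamming_adj.
Proof.
by move=> x y; rewrite /hamming_adj ![x.1 == _]eq_sym ![x.2 == _]eq_sym.
Qed.

Lemma hamming_adj_irrefl : irreflexive hamming_adj.
Proof. by move=> x; rewrite /hamming_adj !eqxx. Qed.

Definition hamming : sgraph := SGraph hamming_adj_sym hamming_adj_irrefl.

Lemma hamming_aut_prod (f g : {perm 'I_k}) :
  exists2 h, h \in aut hamming & h =1 (fun x => (f x.1, g x.2)).
Proof.
apply: aut_of_mono => [x y [/perm_inj e1 /perm_inj e2]|x y].
  by apply/eqP; rewrite -pair_eqE /= e1 e2 !eqxx.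
by rewrite /= /hamming_adj /= !(inj_eq perm_inj).
Qed.

Lemma hamming_aut_swap (f g : {perm 'I_k}) :
  exists2 h, h \in aut hamming & h =1 (fun x => (f x.2, g x.1)).
Proof.
apply: aut_of_mono => [x y [/perm_inj e1 /perm_inj e2]|x y].
  by apply/eqP; rewrite -pair_eqE /= e1 e2 !eqxx.
by rewrite /= /hamming_adj /= !(inj_eq perm_inj) addbC.
Qed.

Lemma hamming_arc_transitive : arc_transitive hamming.
Proof.
split=> [x y|x y u v].
  have [h hA hE] := hamming_aut_prod (tperm x.1 y.1) (tperm x.2 y.2).
  by exists h; rewrite // hE !tpermL -surjective_pairing.
rewrite /= /hamming_adj => xy uv.
(* If both arcs change the same coordinate, permuting each coordinate separately is enough;
   otherwise the two coordinates must also be swapped. *)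
have [e1|ne] := eqVneq (x.1 == y.1) (u.1 == v.1).
  have e2 : (x.2 == y.2) = (u.2 == v.2).
    by move: xy uv; rewrite e1; do 3!case: (_ == _).
  have [f [fx fy]] := perm_pair_transitive e1.
  have [g [gx gy]] := perm_pair_transitive e2.
  have [h hA hE] := hamming_aut_prod f g; exists h => //.
  by rewrite !hE fx fy gx gy -!surjective_pairing.
have e1 : (x.2 == y.2) = (u.1 == v.1).
  by case: (x.1 == y.1) (x.2 == y.2) (u.1 == v.1) ne xy => [] [] [].
have e2 : (x.1 == y.1) = (u.2 == v.2).
  by case: (x.1 == y.1) (u.1 == v.1) (u.2 == v.2) ne uv => [] [] [].
have [f [fx fy]] := perm_pair_transitive e1.
have [g [gx gy]] := perm_pair_transitive e2.
have [h hA hE] := hamming_aut_swap f g; exists h => //.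
by rewrite !hE fx fy gx gy -!surjective_pairing.
Qed.

Lemma hamming_degree : has_degree hamming (k.-1).*2.
Proof.
move=> x.
have -> : [set y | @adj hamming x y] =
    setX [set x.1] [set~ x.2] :|: setX [set~ x.1] [set x.2].
  apply/setP => y; rewrite !inE /= /hamming_adj !(eq_sym x.1) !(eq_sym x.2).
  by do 2!case: (_ == _).
rewrite cardsU (_ : _ :&: _ = set0); last first.
  by apply/setP => y; rewrite !inE; do 2!case: (_ == _).
by rewrite !cardsX !cards1 !cardsC1 card_ord cards0 subn0 mul1n muln1 addnn.
Qed.

Lemma hamming_diameter : diameter_le hamming 2.
Proof.
move=> x y; have [e1|n1] := eqVneq x.1 y.1; have [e2|n2] := eqVneq x.2 y.2.
- exists [::]; split=> //=.
  by rewrite (surjective_pairing x) e1 e2 -surjective_pairing.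
- by exists [:: y]; rewrite /= /hamming_adj e1 eqxx (negbTE n2).
- by exists [:: y]; rewrite /= /hamming_adj e2 eqxx (negbTE n1).
exists [:: (x.1, y.2); y]; split=> //=.
by rewrite /hamming_adj /= !eqxx (negbTE n1) (negbTE n2).
Qed.

Lemma at_order_hamming : at_order (k.-1).*2 2 (k ^ 2).
Proof.
exists hamming; split.
- exact: hamming_arc_transitive.
- exact: hamming_degree.
- exact: hamming_diameter.
by rewrite /graph_order card_prod card_ord mulnn.
Qed.

End Hamming.

(** * Row spaces *)

Section RowSpace.
Local Open Scope ring_scope.
Variables (F : fieldType) (n : nat).
Implicit Type v : 'rV[F]_n.

Lemma mxrank_adds_row (m : nat) (A : 'M[F]_(m, n)) v :
  ~~ (v <= A)%MS -> \rank (A + v)%MS = (\rank A).+1%N.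
Proof.
move=> nvA; apply/eqP; rewrite eqn_leq; apply/andP; split.
  apply: leq_trans (mxrank_adds_leqif _ _).1 _.
  by rewrite -[(\rank A).+1]addn1 leq_add2l rank_leq_row.
by apply: rank_ltmx; rewrite ltmxE addsmxSl addsmx_sub submx_refl nvA.
Qed.

Lemma eq_genmx_rank (m1 m2 : nat) (A : 'M[F]_(m1, n)) (B : 'M[F]_(m2, n)) :
  (A <= B)%MS -> (\rank B <= \rank A)%N -> <<A>>%MS = <<B>>%MS.
Proof.
move=> sAB rBA; apply/genmxP; rewrite sAB /=.
by rewrite -(geq_leqif (mxrank_leqif_sup sAB)).
Qed.

(** Take [a] in [L] outside [A] and [b] in [L] outside [B]. If neither works alone, then [a] lies in
    [B] and [b] in [A], and [a + b] avoids both. *)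
Lemma avoid_two_subspaces (m1 m2 m3 : nat) (L : 'M[F]_(m1, n))
    (A : 'M[F]_(m2, n)) (B : 'M[F]_(m3, n)) :
  ~~ (L <= A)%MS -> ~~ (L <= B)%MS ->
  exists v : 'rV[F]_n, [/\ (v <= L)%MS, ~~ (v <= A)%MS & ~~ (v <= B)%MS].
Proof.
move=> /row_subPn[i ai] /row_subPn[j bj].
set a := row i L in ai *; set b := row j L in bj *.
have aL : (a <= L)%MS by apply: row_sub.
have bL : (b <= L)%MS by apply: row_sub.
have [aB|] := boolP (a <= B)%MS; last by exists a.
have [bA|] := boolP (b <= A)%MS; last by exists b.
exists (a + b); split; first exact: addmx_sub.
  by apply: contra ai => abA; rewrite -(addrK b a) addmx_sub ?eqmx_opp.
by apply: contra bj => abB; rewrite -(addKr a b) addrC addmx_sub ?eqmx_opp.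
Qed.

(** Both matrices are images of the standard frame [row_mx 1%:M 0]. The invertible matrix comes from
    the rank factorization: the column factor is extended by an identity block and multiplied by the
    row factor. *)
Lemma row_free_transitive (k m : nat) (A B : 'M[F]_(k, k + m)) :
  row_free A -> row_free B -> exists2 g, g \in unitmx & A *m g = B.
Proof.
have std (C : 'M[F]_(k, k + m)) : row_free C ->
    exists2 h, h \in unitmx & row_mx 1%:M 0 *m h = C.
  move=> fC; exists (block_mx (col_ebase C) 0 0 1%:M *m row_ebase C).
    rewrite unitmx_mul row_ebase_unit andbT unitmxE det_ublock det1 mulr1.
    by rewrite -unitmxE col_ebase_unit.
  rewrite mulmxA mul_row_block !mul1mx !mul0mx !addr0.
  have {3}<- := mulmx_ebase C; congr (_ *m _).
  by rewrite (eqP fC) pid_mx_row mul_mx_row mulmx1 mulmx0.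
move=> /std[a ua <-] /std[b ub <-]; exists (invmx a *m b).
  by rewrite unitmx_mul unitmx_inv ua.
by rewrite -!mulmxA mulKVmx.
Qed.

End RowSpace.

(** * The flag graph *)

Section Flags.
Variables (F : finFieldType) (m : nat).
Local Notation n := m.+3.
Local Notation q := #|F|.
Local Open Scope ring_scope.
Implicit Types (u v r s : 'rV[F]_n) (x y : 'M[F]_n * 'M[F]_n).

(* A subspace is represented by its canonical matrix [<<A>>], so that flags of
   PG(n - 1, q) form a finite type with Leibniz equality. *)
Definition is_flag x : bool :=
  [&& <<x.1>>%MS == x.1, <<x.2>>%MS == x.2, \rank x.1 == 1%N,
      \rank x.2 == 2%N & (x.1 <= x.2)%MS].

Definition flag_adj : rel ('M[F]_n * 'M[F]_n) := fun x y =>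
  [&& ~~ (x.1 <= y.2)%MS, ~~ (y.1 <= x.2)%MS & (x.2 :&: y.2)%MS != 0].

Definition span_flag u v : 'M[F]_n * 'M[F]_n := (<<u>>%MS, <<(u + v)%MS>>%MS).

Lemma flagP x : is_flag x ->
  [/\ <<x.1>>%MS = x.1, <<x.2>>%MS = x.2, \rank x.1 = 1%N, \rank x.2 = 2%N
    & (x.1 <= x.2)%MS].
Proof. by case/and5P=> /eqP ? /eqP ? /eqP ? /eqP ?. Qed.

Lemma is_flag_span u v : u != 0 -> ~~ (v <= u)%MS -> is_flag (span_flag u v).
Proof.
move=> u0 uv; rewrite /is_flag /= !genmx_id !eqxx !genmxE mxrank_adds_row //.
by rewrite !rank_rV u0 addsmxSl.
Qed.

Lemma span_flag_eq x u v : is_flag x -> u != 0 -> (u <= x.1)%MS ->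
  (v <= x.2)%MS -> ~~ (v <= x.1)%MS -> span_flag u v = x.
Proof.
move=> /flagP[g1 g2 r1 r2 s12] u0 ux vx nvx.
have nvu : ~~ (v <= u)%MS by apply: contra nvx => /submx_trans->.
rewrite [RHS]surjective_pairing -g1 -g2; congr pair.
  by apply: eq_genmx_rank => //; rewrite r1 rank_rV u0.
apply: eq_genmx_rank; first by rewrite addsmx_sub vx (submx_trans ux).
by rewrite r2 mxrank_adds_row // rank_rV u0.
Qed.

Lemma flag_point x : is_flag x -> exists2 u : 'rV[F]_n, (u <= x.1)%MS & u != 0.
Proof.
move=> /flagP[_ _ r1 _ _]; apply/rowV0Pn.
by rewrite -mxrank_eq0 r1.
Qed.

Lemma flag_point_sub x u : is_flag x -> u != 0 -> (u <= x.1)%MS ->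
  (x.1 <= u)%MS.
Proof.
move=> /flagP[_ _ r1 _ _] u0 ux; rewrite -(geq_leqif (mxrank_leqif_sup ux)).
by rewrite r1 rank_rV u0.
Qed.

Lemma flag_line_nsub_point x : is_flag x -> ~~ (x.2 <= x.1)%MS.
Proof.
move=> /flagP[_ _ r1 r2 _]; apply/negP => /mxrankS.
by rewrite r1 r2.
Qed.

Lemma nsub_row_sym r s : r != 0 -> ~~ (s <= r)%MS -> ~~ (r <= s)%MS.
Proof.
move=> r0; apply: contra => rs; rewrite -(geq_leqif (mxrank_leqif_sup rs)).
by rewrite !rank_rV r0; case: (s != 0).
Qed.

Lemma nsub_neq0 (k : nat) (A : 'M[F]_(k, n)) v : ~~ (v <= A)%MS -> v != 0.
Proof. by apply: contraNneq => ->; apply: sub0mx. Qed.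

(** With [flag_adj_sub], this parametrizes the neighbours of [x]: [s] spans the point of the
    neighbour and [r] the point where the two lines meet. *)
Lemma flag_adj_span x s r : is_flag x -> (r <= x.2)%MS -> ~~ (r <= x.1)%MS ->
  ~~ (s <= x.2)%MS -> is_flag (span_flag s r) && flag_adj x (span_flag s r).
Proof.
move=> xF rx2 nrx1 nsx2; have r0 := nsub_neq0 nrx1; have s0 := nsub_neq0 nsx2.
have nrs : ~~ (r <= s)%MS.
  by apply: nsub_row_sym => //; apply: contra nsx2 => /submx_trans->.
have [g1 g2 r1 r2 s12] := flagP xF.
rewrite is_flag_span //= /flag_adj /= !genmxE nsx2 /=; apply/andP; split.
  (* If the new line contained the point [x.1] besides [r], it would contain [x.2], hence equal it
     by rank, and [s] would lie on [x.2]. *)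
  apply: contra nsx2 => sx1.
  have xsr : (x.2 <= s + r)%MS.
    have sx : (x.1 + r <= x.2)%MS by rewrite addsmx_sub s12.
    have xs : (x.2 <= x.1 + r)%MS.
      by rewrite -(geq_leqif (mxrank_leqif_sup sx)) mxrank_adds_row // r1 r2.
    by apply: submx_trans xs _; rewrite addsmx_sub sx1 addsmxSr.
  apply: submx_trans (addsmxSl s r) _.
  rewrite -(geq_leqif (mxrank_leqif_sup xsr)) mxrank_adds_row //.
  by rewrite rank_rV s0 r2.
apply/rowV0Pn; exists r => //.
by rewrite sub_capmx rx2 genmxE addsmxSr.
Qed.

Lemma flag_adj_sym : symmetric flag_adj.
Proof. by move=> x y; rewrite /flag_adj capmxC andbCA. Qed.

(** A common vector [r] of the two lines cannot lie in [x.1]: being nonzero it would span that point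
    and put it on [y.2]. The same argument with [x] and [y] exchanged shows that [r] is off [y.1],
    so [s] and [r] span the line of [y]. *)
Lemma flag_adj_sub x y s r : is_flag x -> is_flag y -> flag_adj x y ->
  s != 0 -> (s <= y.1)%MS -> r != 0 -> (r <= x.2)%MS -> (r <= y.2)%MS ->
  [/\ ~~ (s <= x.2)%MS, ~~ (r <= x.1)%MS & span_flag s r = y].
Proof.
move=> xF yF /and3P[nxy nyx _] s0 sy r0 rx ry.
have nr (z z' : 'M[F]_n * 'M[F]_n) : is_flag z -> ~~ (z.1 <= z'.2)%MS ->
    (r <= z'.2)%MS -> ~~ (r <= z.1)%MS.
  move=> zF nz rz; apply: contra nz => rz1.
  by apply: submx_trans rz; apply: flag_point_sub.
split; first 1 last.
- exact: nr nxy ry.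
- by apply: span_flag_eq => //; apply: nr nyx rx.
by apply: contra nyx; apply: submx_trans; apply: flag_point_sub.
Qed.

(** The vectors span, in order, the point of [x], the meeting point of the two lines and the point
    of [y]. Transitivity on arcs thus reduces to transitivity on independent triples. *)
Lemma flag_arc x y : is_flag x -> is_flag y -> flag_adj x y ->
  exists p r s : 'rV[F]_n, [/\ p != 0, ~~ (r <= p)%MS, ~~ (s <= p + r)%MS,
    x = span_flag p r & y = span_flag s r].
Proof.
move=> xF yF xy; have /and3P[_ _ /rowV0Pn[r]] := xy.
rewrite sub_capmx => /andP[rx ry] r0.
have [p px p0] := flag_point xF; have [s sy s0] := flag_point yF.
have [nsx nrx ysr] := flag_adj_sub xF yF xy s0 sy r0 rx ry.
have yx : flag_adj y x by rewrite flag_adj_sym.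
have [_ _ xpr] := flag_adj_sub yF xF yx p0 px r0 ry rx.
exists p, r, s; split=> //; first by apply: contra nrx => /submx_trans->.
by apply: contra nsx => /submx_trans->//; rewrite -xpr /= genmxE.
Qed.

(** * The action of the general linear group on flags *)

Definition flag_act (g : 'M[F]_n) x : 'M[F]_n * 'M[F]_n :=
  (<<x.1 *m g>>%MS, <<x.2 *m g>>%MS).

Lemma flag_act_span g u v :
  flag_act g (span_flag u v) = span_flag (u *m g) (v *m g).
Proof.
congr pair; apply: eq_genmx; first exact: eqmxMr (genmxE _).
by apply: eqmx_trans (eqmxMr _ (genmxE _)) (addsmxMr _ _ _).
Qed.

Lemma is_flag_act g x : g \in unitmx -> is_flag x -> is_flag (flag_act g x).
Proof.
move=> gU /flagP[_ _ r1 r2 s12]; have fg : row_free g by rewrite row_free_unit.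
by rewrite /is_flag /= !genmx_id !eqxx !genmxE !mxrankMfree // r1 r2 submxMfree.
Qed.

Lemma flag_act_inj g x y : g \in unitmx -> is_flag x -> is_flag y ->
  flag_act g x = flag_act g y -> x = y.
Proof.
move=> gU /flagP[x1 x2 _ _ _] /flagP[y1 y2 _ _ _] [/genmxP + /genmxP].
have fg : row_free g by rewrite row_free_unit.
rewrite !submxMfree // => /genmxP e1 /genmxP e2.
by rewrite (surjective_pairing x) (surjective_pairing y) -x1 -x2 -y1 -y2 e1 e2.
Qed.

Lemma flag_adj_act g x y : g \in unitmx ->
  flag_adj (flag_act g x) (flag_act g y) = flag_adj x y.
Proof.
move=> gU; have fg : row_free g by rewrite row_free_unit.
rewrite /flag_adj /= !genmxE !submxMfree // -!mxrank_eq0.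
suff -> : \rank (<<x.2 *m g>> :&: <<y.2 *m g>>)%MS =
  \rank (x.2 :&: y.2)%MS by [].
(* The rank of the intersection is read off from that of the sum, since sums commute with
   multiplication by [g]. *)
apply: (@addnI (\rank (x.2 + y.2)%MS)); rewrite mxrank_sum_cap.
rewrite -(mxrankMfree (x.2 + y.2)%MS fg) addsmxMr.
have -> : \rank (x.2 *m g + y.2 *m g)%MS =
    \rank (<<x.2 *m g>> + <<y.2 *m g>>)%MS.
  by rewrite (adds_eqmx (genmxE _) (genmxE _)).
by rewrite mxrank_sum_cap !genmxE !mxrankMfree.
Qed.

Lemma independent_triple_transitive (p r s p' r' s' : 'rV[F]_n) :
  p != 0 -> ~~ (r <= p)%MS -> ~~ (s <= p + r)%MS ->
  p' != 0 -> ~~ (r' <= p')%MS -> ~~ (s' <= p' + r')%MS ->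
  exists2 g, g \in unitmx & [/\ p *m g = p', r *m g = r' & s *m g = s'].
Proof.
have free3 (u v w : 'rV[F]_n) : u != 0 -> ~~ (v <= u)%MS ->
    ~~ (w <= u + v)%MS -> row_free (col_mx (col_mx u v) w).
  move=> u0 vu wuv; rewrite /row_free -addsmxE.
  rewrite -(adds_eqmx (addsmxE u v) (eqmx_refl w)).
  by rewrite !mxrank_adds_row // rank_rV u0.
move=> p0 rp spr p'0 rp' spr'.
(* The dimension [m.+3] is convertible to [3 + m], so the three stacked rows fit
   [row_free_transitive]. *)
have [g gU] := @row_free_transitive F 3 m _ _ (free3 _ _ _ p0 rp spr)
  (free3 _ _ _ p'0 rp' spr').
move=> e; exists g => //; move: e.
rewrite (@mul_col_mx _ 2 1) (@mul_col_mx _ 1 1).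
by move=> /(@eq_col_mx _ 2 1)[/(@eq_col_mx _ 1 1)[-> ->] ->].
Qed.

(** * Arc-transitivity and diameter of the flag graph *)

Definition flag : finType := {x : 'M[F]_n * 'M[F]_n | is_flag x}.

Lemma flag_graph_sym : symmetric (fun x y : flag => flag_adj (val x) (val y)).
Proof. by move=> x y; apply: flag_adj_sym. Qed.

Lemma flag_graph_irrefl :
  irreflexive (fun x y : flag => flag_adj (val x) (val y)).
Proof.
move=> x; rewrite /flag_adj; by have [_ _ _ _ ->] := flagP (valP x).
Qed.

Definition flag_graph : sgraph := SGraph flag_graph_sym flag_graph_irrefl.

Lemma flag_act_aut (g : 'M[F]_n) : g \in unitmx ->
  exists2 f, f \in aut flag_graph
    & forall x : flag, val (f x) = flag_act g (val x).
Proof.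
move=> gU.
pose h (x : flag) : flag := Sub (flag_act g (val x)) (is_flag_act gU (valP x)).
have [||f fA fE] := @aut_of_mono flag_graph h.
- move=> x y /(congr1 val); rewrite /= => /(flag_act_inj gU (valP x) (valP y)).
  exact: val_inj.
- by move=> x y; apply: flag_adj_act.
by exists f => // x; rewrite fE.
Qed.

Lemma flag_graph_arcs_transitive (x y x' y' : flag_graph) :
  adj x y -> adj x' y' ->
  exists2 f, f \in aut flag_graph & f x = x' /\ f y = y'.
Proof.
move=> /(flag_arc (valP x) (valP y))[p [r [s [p0 rp spr xE yE]]]].
move=> /(flag_arc (valP x') (valP y'))[p' [r' [s' [p0' rp' spr' xE' yE']]]].
have [g gU [gp gr gs]] :=
  independent_triple_transitive p0 rp spr p0' rp' spr'.
have [f fA fE] := flag_act_aut gU; exists f => //.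
split; apply: val_inj; rewrite /= fE.
  by rewrite xE xE' flag_act_span gp gr.
by rewrite yE yE' flag_act_span gs gr.
Qed.

Lemma flag_line_extend (x : flag) : exists s : 'rV[F]_n, ~~ (s <= (val x).2)%MS.
Proof.
have [_ _ _ r2 _] := flagP (valP x).
have /row_subPn[i si] : ~~ ((1%:M : 'M[F]_n) <= (val x).2)%MS.
  by apply/negP => /mxrankS; rewrite r2 mxrank1.
by eexists; apply: si.
Qed.

Lemma flag_graph_adj_span (x : flag_graph) s r : (r <= (val x).2)%MS ->
  ~~ (r <= (val x).1)%MS -> ~~ (s <= (val x).2)%MS ->
  exists2 y : flag_graph, adj x y & val y = span_flag s r.
Proof.
move=> rx nrx nsx; have /andP[yF xy] := flag_adj_span (valP x) rx nrx nsx.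
by exists (Sub (span_flag s r) yF); rewrite //= SubK.
Qed.

Lemma flag_graph_neighbour (x : flag_graph) : exists y : flag_graph, adj x y.
Proof.
have [s ns] := flag_line_extend x.
have /row_subPn[i nr] := flag_line_nsub_point (valP x).
by have [y xy _] := flag_graph_adj_span (row_sub i _) nr ns; exists y.
Qed.

(** Every vertex starts an arc, so transitivity on arcs implies transitivity on vertices. *)
Lemma flag_graph_arc_transitive : arc_transitive flag_graph.
Proof.
split=> [x x'|]; last exact: flag_graph_arcs_transitive.
have [y xy] := flag_graph_neighbour x; have [y' xy'] := flag_graph_neighbour x'.
by have [f fA [fx _]] := flag_graph_arcs_transitive xy xy'; exists f.
Qed.

(** Any two vertices, equal or adjacent ones included, have a common neighbour. It is built once
    from [x] and once from [y], and the two flags obtained are shown to coincide. *)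
Lemma flag_graph_diameter : diameter_le flag_graph 2.
Proof.
move=> x y; suff [z xz zy] : exists2 z : flag_graph, adj x z & adj z y.
  by exists [:: z; y]; split=> //; apply/and3P.
have xF := valP x; have yF := valP y.
have [gx1 gx2 rx1 rx2 sx] := flagP xF; have [gy1 gy2 ry1 ry2 sy] := flagP yF.
have [exy|nexy] := eqVneq (val x).2 (val y).2.
  have [s ns] := flag_line_extend x.
  have ny : ~~ ((val x).2 <= (val y).1)%MS.
    by rewrite exy; apply: flag_line_nsub_point.
  have [r [rx nr nr']] := avoid_two_subspaces (flag_line_nsub_point xF) ny.
  have [z xz zE] := flag_graph_adj_span rx nr ns.
  exists z => //; rewrite exy in rx ns.
  have [z' yz' zE'] := flag_graph_adj_span rx nr' ns.
  by rewrite adj_sym (_ : z = z') //; apply: val_inj; rewrite zE zE'.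
have nxy : ~~ ((val x).2 <= (val y).2)%MS.
  apply: contra nexy => sxy; apply/eqP; rewrite -gx2 -gy2.
  by apply: eq_genmx_rank; rewrite // rx2 ry2.
have nyx : ~~ ((val y).2 <= (val x).2)%MS.
  apply: contra nexy => sxy; apply/eqP; rewrite -gx2 -gy2; apply: esym.
  by apply: eq_genmx_rank; rewrite // rx2 ry2.
(* Since [a] is on [x.2] only and [b] on [y.2] only, [a + b] is on neither line. *)
have [a [ax nax nay]] := avoid_two_subspaces (flag_line_nsub_point xF) nxy.
have [b [bY nby nbx]] := avoid_two_subspaces (flag_line_nsub_point yF) nyx.
have nsx : ~~ ((a + b)%R <= (val x).2)%MS.
  by apply: contra nbx => h; rewrite -(addKr a b) addmx_sub ?eqmx_opp.
have nsy : ~~ ((a + b)%R <= (val y).2)%MS.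
  by apply: contra nay => h; rewrite -(addrK b a) addmx_sub ?eqmx_opp.
have [z xz zE] := flag_graph_adj_span ax nax nsx.
have [z' yz' zE'] := flag_graph_adj_span bY nby nsy.
(* The vector [a + b] spans the same line with [a] as with [b]. *)
exists z => //; rewrite adj_sym (_ : z = z') //; apply: val_inj.
rewrite zE zE'; congr pair; apply/genmxP; rewrite !addsmx_sub !addsmxSl /=.
apply/andP; split.
  by rewrite -{1}(addrK b a) addmx_sub ?eqmx_opp ?addsmxSr ?addsmxSl.
by rewrite -{1}(addKr a b) addmx_sub ?eqmx_opp ?addsmxSr ?addsmxSl.
Qed.

(** * Counting flags and neighbours *)

Lemma card_nsub_row (k : nat) (A : 'M[F]_(k, n)) :
  #|~: rowg A| = (q ^ n - q ^ \rank A)%N.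
Proof. by rewrite cardsCs setCK card_rowg card_mx mul1n. Qed.

Lemma card_sub_row_neq0 (k : nat) (A : 'M[F]_(k, n)) :
  #|rowg A :\ 0| = (q ^ \rank A - 1)%N.
Proof.
by rewrite -card_rowg (cardsD1 0 (rowg A)) inE sub0mx addnC addnK.
Qed.

Lemma card_flag_diff x : is_flag x ->
  #|rowg x.2 :\: rowg x.1| = (q ^ 2 - q)%N.
Proof.
case/flagP=> _ _ r1 r2 s12.
by rewrite cardsDS ?rowgS // !card_rowg r1 r2 expn1.
Qed.

(** Both sides count the independent pairs [(u, v)]. A given flag is spanned by [q - 1] choices of
    [u] and [q ^ 2 - q] choices of [v]; counting by [u] first gives the right-hand side. *)
Lemma card_flag :
  (#|flag| * ((q - 1) * (q ^ 2 - q)) = (q ^ n - 1) * (q ^ n - q))%N.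
Proof.
pose D : {set 'rV[F]_n * 'rV[F]_n} :=
  [set p | (p.1 != 0) && ~~ (p.2 <= p.1)%MS].
transitivity #|D|.
  have -> : #|flag| = #|[set x | is_flag x]| by rewrite card_sig cardsE.
  apply/esym.
  apply: (@card_fibers _ _ (fun p => span_flag p.1 p.2)).
    by move=> p; rewrite !inE => /andP[]; apply: is_flag_span.
  move=> x; rewrite inE => xF; have [_ _ r1 r2 s12] := flagP xF.
  have -> : (q - 1)%N = #|rowg x.1 :\ 0| by rewrite card_sub_row_neq0 r1 expn1.
  rewrite -(card_flag_diff xF) -cardsX.
  apply: eq_card => p; rewrite !inE; apply/idP/idP.
    case/andP=> /andP[p0 np] /eqP <- /=.
    by rewrite p0 !genmxE np addsmxSr submx_refl.
  case/andP=> /andP[p0 px] /andP[np2 p2].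
  rewrite p0 (span_flag_eq xF) // eqxx andbT /=.
  by apply: contra np2 => /submx_trans->.
have -> : (q ^ n - 1)%N = #|[set~ (0 : 'rV[F]_n)]|.
  by rewrite cardsC1 card_mx mul1n subn1.
apply: (@card_fibers _ _ (fun p => p.1)) => [p|u]; rewrite !inE.
  by case/andP.
move=> u0; have -> : (q ^ n - q)%N = #|setX [set u] (~: rowg u)|.
  by rewrite cardsX cards1 mul1n card_nsub_row rank_rV u0 expn1.
apply: eq_card => -[u' v]; rewrite !inE /= andbC; apply: andb_id2l => /eqP->.
by rewrite u0.
Qed.

(** Both sides count the pairs [(s, r)] with [s] off [x.2] and [r] on [x.2] off [x.1]. A neighbour
    [y] determines [s] and [r] up to nonzero scalars, which gives the factor [(q - 1) * (q - 1)]. *)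
Lemma card_flag_neighbours x : is_flag x ->
  (#|[set y | is_flag y & flag_adj x y]| * ((q - 1) * (q - 1)) =
    (q ^ n - q ^ 2) * (q ^ 2 - q))%N.
Proof.
move=> xF; have [_ _ r1 r2 s12] := flagP xF.
have -> : (q ^ n - q ^ 2)%N = #|~: rowg x.2| by rewrite card_nsub_row r2.
rewrite -(card_flag_diff xF) -cardsX.
apply/esym.
  apply: (@card_fibers _ _ (fun p => span_flag p.1 p.2)).
  move=> p; rewrite !inE => /andP[nsx /andP[nrx rx]].
  exact: flag_adj_span.
move=> y; rewrite inE => /andP[yF xy]; have [_ _ s1 s2 t12] := flagP yF.
(* The lines differ because [x.1] is not on [y.2], so their nonzero intersection is a point. *)
have rc : \rank (x.2 :&: y.2)%MS = 1%N.
  have /and3P[nxy _ c0] := xy.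
  apply/eqP; rewrite eqn_leq lt0n mxrank_eq0 c0 andbT -ltnS -r2.
  rewrite ltn_neqAle mxrankS ?capmxSl // andbT.
  apply: contra nxy => /eqP e; apply: submx_trans s12 _.
  apply: submx_trans (capmxSr x.2 y.2).
  by rewrite -(geq_leqif (mxrank_leqif_sup (capmxSl x.2 y.2))) e.
have -> : ((q - 1) * (q - 1))%N =
    #|setX (rowg y.1 :\ 0) (rowg (x.2 :&: y.2)%MS :\ 0)|.
  by rewrite cardsX !card_sub_row_neq0 s1 rc expn1.
apply: eq_card => -[s r]; rewrite !inE /= sub_capmx; apply/idP/idP.
  case/andP=> /andP[nsx /andP[nrx rx]] /eqP <- /=.
  by rewrite rx !genmxE submx_refl addsmxSr (nsub_neq0 nsx) (nsub_neq0 nrx).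
case/andP=> /andP[s0 sy] /and3P[r0 rx ry].
have [-> -> ->] := flag_adj_sub xF yF xy s0 sy r0 rx ry.
by rewrite rx eqxx.
Qed.

Lemma flag_graph_degree : has_degree flag_graph (q ^ 3 * \sum_(i < m.+1) q ^ i).
Proof.
move=> x; have := card_flag_neighbours (valP x).
have -> : #|[set y | is_flag y & flag_adj (val x) y]| = #|[set y | adj x y]|.
  rewrite -(card_imset _ val_inj); apply: eq_card => y; rewrite !inE.
  apply/andP/imsetP => [[yF xy]|[z]]; first by exists (Sub y yF); rewrite ?inE.
  by rewrite inE => xz ->; split=> //; apply: valP.
have q1 : (1 < q)%N by apply: card_finNzRing_gt1.
have -> : (q ^ n - q ^ 2 = q ^ 2 * ((q - 1) * \sum_(i < m.+1) q ^ i))%N.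
  by rewrite -subn1_exp mulnBr muln1 -expnD.
have -> : (q ^ 2 - q = q * (q - 1))%N by rewrite mulnBr muln1.
move=> e; apply/eqP; rewrite -(@eqn_pmul2r ((q - 1) * (q - 1))).
  by rewrite e; apply/eqP; ring.
by rewrite muln_gt0 subn_gt0 q1.
Qed.

Lemma flag_graph_order :
  graph_order flag_graph =
    ((\sum_(i < m.+3) q ^ i) * (\sum_(i < m.+2) q ^ i))%N.
Proof.
have q1 : (1 < q)%N by apply: card_finNzRing_gt1.
have := card_flag; rewrite subn1_exp.
have -> : (q ^ n - q = q * ((q - 1) * \sum_(i < m.+2) q ^ i))%N.
  by rewrite -subn1_exp mulnBr muln1 -expnS.
have -> : (q ^ 2 - q = q * (q - 1))%N by rewrite mulnBr muln1.
move=> e; apply/eqP; rewrite -(@eqn_pmul2r ((q - 1) * (q * (q - 1)))).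
  by rewrite e; apply/eqP; ring.
by rewrite !muln_gt0 subn_gt0 q1 ltnW.
Qed.

Lemma at_order_flag_graph :
  at_order (q ^ 3 * \sum_(i < m.+1) q ^ i) 2
    ((\sum_(i < m.+3) q ^ i) * (\sum_(i < m.+2) q ^ i)).
Proof.
exists flag_graph; split.
- exact: flag_graph_arc_transitive.
- exact: flag_graph_degree.
- exact: flag_graph_diameter.
exact: flag_graph_order.
Qed.

End Flags.

(** * The two bounds *)

Lemma infinite_set_nat (A : set nat) :
  (forall M : nat, exists2 D : nat, M <= D & A D) -> infinite_set A.
Proof.
move=> unbA /finite_seqP[s As].
have [D DM AD] := unbA (\max_(i <- s) i).+1.
have Ds : D \in s by move: AD; rewrite As.
by have := @leq_bigmax_seq _ s xpredT id D Ds isT; rewrite leqNgt DM.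
Qed.

Local Open Scope classical_set_scope.
Local Open Scope ring_scope.

(* With [t = D `^ (eps / 3)], the left-hand side is [D^2/t^3 + 2D/t + D/t^2 + 3]
   and [q <= t]; the slack in the final comparison is [q + 1 > 3]. *)
Lemma flag_bound (R : realType) (eps : R) (q m D : nat) :
  (2 < q)%N -> 0 < eps -> 3 / eps <= m.+3%:R ->
  D = (q ^ 3 * \sum_(i < m.+1) q ^ i)%N ->
  D%:R `^ (2 - eps) + 2 * D%:R `^ (1 - eps / 3) + D%:R `^ (1 - 2 * eps / 3) + 3
    < ((\sum_(i < m.+3) q ^ i) * (\sum_(i < m.+2) q ^ i))%N%:R :> R.
Proof.
move=> q2 eps0 epsd; set x := (\sum_(i < m.+1) q ^ i)%N => Dx.
have q0 : 0 < q%:R :> R by rewrite ltr0n ltnW // ltnW.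
have qdD : (q ^ m.+3 <= D)%N.
  by rewrite Dx /x big_ord_recr /= mulnDr -expnD leq_addl.
have D0 : 0 < D%:R :> R.
  by rewrite ltr0n (leq_trans _ qdD) // expn_gt0 ltnW // ltnW.
have D1 : 1 <= D%:R :> R by rewrite ler1n -(ltr0n R).
set t : R := D%:R `^ (eps / 3).
have t0 : 0 < t by apply: powR_gt0.
(* With [d = m.+3], [q] is the [d]-th root of [q ^ d <= D], and [1 / d <= eps / 3]. *)
have qt : q%:R <= t.
  apply: (@le_trans _ _ (D%:R `^ (m.+3%:R^-1))); last first.
    apply: ler_powR => //; rewrite -[eps / 3]invrK.
    rewrite lef_pV2 ?posrE ?invr_gt0 ?divr_gt0 //.
    by rewrite invf_div.
  have {1}-> : q%:R = (q ^ m.+3)%:R `^ (m.+3%:R^-1) :> R.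
    by rewrite natrX -powR_mulrn ?ltW // -powRrM divff ?powRr1 ?ltW.
  by apply: ge0_ler_powR; rewrite ?nnegrE ?invr_ge0 ?ler_nat.
have tX k : D%:R `^ (k%:R * (eps / 3)) = t ^+ k.
  by rewrite mulrC powRrM powR_mulrn // ltW.
have D_neq0 : D%:R != 0 :> R by rewrite gt_eqF.
have e1 : D%:R `^ (2 - eps) = D%:R ^+ 2 / t ^+ 3.
  rewrite powRB ?D_neq0 ?implybT // powR_mulrn ?ltW // -tX.
  by congr (_ / _ `^ _); field.
have e2 : D%:R `^ (1 - eps / 3) = D%:R / t.
  by rewrite powRB ?D_neq0 ?implybT // powRr1 // ltW.
have e3 : D%:R `^ (1 - 2 * eps / 3) = D%:R / t ^+ 2.
  by rewrite powRB ?D_neq0 ?implybT // powRr1 ?ltW // -tX mulrA.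
have DE : D%:R = q%:R ^+ 3 * x%:R :> R by rewrite Dx natrM natrX.
have tq k : (t ^+ k)^-1 <= (q%:R ^+ k)^-1.
  rewrite lef_pV2 ?posrE ?exprn_gt0 //.
  by apply: lerXn2r; rewrite ?nnegrE // ltW.
(* In each term [t] occurs only in the denominator, so it may be replaced by the smaller [q]; then
   [D = q ^ 3 * x] clears the fraction. *)
have b1 : D%:R `^ (2 - eps) <= q%:R ^+ 3 * x%:R ^+ 2.
  rewrite e1; apply: le_trans (ler_wpM2l _ (tq 3)) _.
    by rewrite exprn_ge0 ?ltW.
  by rewrite DE le_eqVlt; apply/orP; left; apply/eqP; field; rewrite gt_eqF.
have b2 : D%:R `^ (1 - eps / 3) <= q%:R ^+ 2 * x%:R.
  rewrite e2; apply: le_trans (ler_wpM2l _ (tq 1%N)) _; first exact: ltW.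
  by rewrite DE le_eqVlt; apply/orP; left; apply/eqP; field; rewrite gt_eqF.
have b3 : D%:R `^ (1 - 2 * eps / 3) <= q%:R * x%:R.
  rewrite e3; apply: le_trans (ler_wpM2l _ (tq 2)) _; first exact: ltW.
  by rewrite DE le_eqVlt; apply/orP; left; apply/eqP; field; rewrite gt_eqF.
have shift k : (\sum_(i < k.+1) q ^ i = 1 + q * \sum_(i < k) q ^ i)%N.
  rewrite big_ord_recl expn0 big_distrr /=; congr addn.
  by apply: eq_bigr => i _; rewrite -expnS.
(* The order becomes [(1 + q * (1 + q * x)) * (1 + q * x)], and the comparison is linear in the
   monomials in [q] and [x]. *)
rewrite (shift m.+2) (shift m.+1) -/x !(natrM, natrD).
have q3 : 3 <= q%:R :> R by rewrite ler_nat.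
by move: b1 b2 b3 q3; lra.
Qed.

Theorem proposition1 (R : realType) :
  (forall D : nat, (2 <= D)%N -> ~~ odd D ->
     (N_at D 2)%:R >= 4^-1 * (D%:R + 2) ^+ 2 :> R)
  /\
  (forall eps : R, 0 < eps -> eps < 1 ->
     infinite_set [set D : nat | [/\ odd D,
       exists q d : nat,
         [/\ prime_power q, odd q, odd d, 3 / eps <= d%:R
           & D = ((q ^ 3 * (q ^ (d - 2) - 1)) %/ (q - 1))%N]
     & (N_at D 2)%:R >
         D%:R `^ (2 - eps) + 2 * D%:R `^ (1 - eps / 3)
           + D%:R `^ (1 - 2 * eps / 3) + 3 :> R]]).
Proof.
split=> [D D2 oD|eps eps0 eps1].
  have DE : D = (D./2).*2 by rewrite even_halfK.
  (* For [k = D / 2 + 1] the degree [2 * (k - 1)] is [D] and the order [k ^ 2] is a quarter of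
     [(D + 2) ^ 2]. *)
  have := @N_at_ge _ 2 _ isT (at_order_hamming (D./2).+1); rewrite /= -DE.
  rewrite -(ler_nat R); apply: le_trans.
  rewrite {1}DE -addnn natrX natrD -natr1 le_eqVlt; apply/orP; left.
  by apply/eqP; field.
apply: infinite_set_nat => M.
(* Doubling makes [m] even, so that [d = m.+3] and the number [m.+1] of terms in the degree's sum
   are odd. The summand [M] makes the degree at least [M], the other gives [3 / eps <= d]. *)
pose m := (M + Num.truncn (3 / eps)).*2.
have epsm : 3 / eps <= m.+3%:R.
  have /andP[_ /ltW h] := truncn_itv (ltW (divr_gt0 (ltr0n R 3) eps0)).
  by apply: le_trans h _; rewrite ler_nat /m; move: (Num.truncn _) => k; lia.
have card3 : #|'F_3| = 3%N by rewrite card_Fp.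
have := at_order_flag_graph 'F_3 m; rewrite card3 => /(@N_at_ge _ 2 _ isT) N3.
exists (3 ^ 3 * \sum_(i < m.+1) 3 ^ i)%N.
  (* The last term alone suffices, as [3 ^ m > m >= M]. *)
  apply: (@leq_trans (\sum_(i < m.+1) 3 ^ i)%N); last by rewrite leq_pmull.
  rewrite big_ord_recr /=; apply: leq_trans (leq_addl _ _).
  by apply: leq_trans (ltnW (ltn_expl m _)); rewrite // /m; lia.
split.
- by rewrite oddM odd_geometric_sum //= odd_double.
- exists 3%N, m.+3; split=> //.
  + by exists 3%N, 1%N.
  + by rewrite /= negbK odd_double.
  + rewrite (_ : m.+3 - 2 = m.+1)%N; last by lia.
    by rewrite subn1_exp mulnCA mulKn.
apply: lt_le_trans (flag_bound _ eps0 epsm erefl) _ => //.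
by rewrite ler_nat.
Qed.
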